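(* Let $\mathcal{S}$ and $\mathcal{A}$ be finite sets of states and actions. Let $H>0$ be a positive integer and $\epsilon\in(0,1/2)$ be an error parameter. Let $\mathcal{K}$ be an algorithm that, on input an $H$-MDP $\mathcal{M}=(\mathcal{S},\mathcal{A},P,\boldsymbol{r})$ with a sampling oracle, outputs a value function $\boldsymbol{v}_1$ for the first stage such that $\|\boldsymbol{v}_1-\boldsymbol{v}_1^*\|_\infty\le\epsilon$ with probability at least $0.9$. Then $\mathcal{K}$ calls the sampling oracle at least $$\Omega\left(\frac{H^{3}\epsilon^{-2}|\mathcal{S}||\mathcal{A}|}{\log\epsilon^{-1}}\right)$$ times on some input $P$ and $\boldsymbol{r}\in[0,1]^{\mathcal{S}}$.
   Context: An $H$-MDP (finite-horizon MDP with horizon $H$) has a finite state space $\mathcal{S}$, finite action space $\mathcal{A}$, stage-independent transition probability vectors $P(\cdot\mid s,a)=\boldsymbol{P}_{s,a}$ over $\mathcal{S}$, and known rewards in $[0,1]$ (a reward $\boldsymbol{r}\in[0,1]^{\mathcal{S}}$ depends only on the state, i.e. $\boldsymbol{r}(s,a)=\boldsymbol{r}(s)$). The algorithm accesses $P$ only through a sampling oracle which, given $(s,a)$, returns an independent sample of a state from $P(\cdot\mid s,a)$. The optimal stage values are $\boldsymbol{v}^*_{H+1}=\boldsymbol{0}$ and $\boldsymbol{v}^*_h(s)=\max_{a\in\mathcal{A}}[\boldsymbol{r}(s,a)+\boldsymbol{P}_{s,a}^\top\boldsymbol{v}^*_{h+1}]$ for $h=H,\dots,1$. $\Omega(\cdot)$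 is the usual asymptotic lower-bound notation, hiding an absolute constant.
   Formalization: The bound is stated for H ≥ 2 and |S| ≥ 2; for H = 1 (v*_1 = r is known) or |S| = 1 (P is trivial) zero oracle calls suffice while the claimed bound is positive, so the claim fails there. *)

(* Defs.v *)
From HB Require Import structures.
From mathcomp Require Import all_boot all_order all_algebra.
From mathcomp Require Import all_classical all_reals all_analysis.

Set Implicit Arguments.
Unset Strict Implicit.
Unset Printing Implicit Defensive.

Import Order.TTheory GRing.Theory Num.Theory.

Local Open Scope classical_set_scope.
Local Open Scope ring_scope.

Definition is_transition (R : realType) (S A : finType) (P : S -> A -> S -> R) :=
  forall s a, (forall s', 0 <= P s a s') /\ \sum_(s' : S) P s a s' = 1.

Definition is_reward (R : realType) (S : finType) (r : S -> R) :=
  forall s, 0 <= r s <= 1.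

(* The maximum over actions is written with neutral element 0; the maximised
   quantities are nonnegative as soon as r and v are, so this is the plain
   maximum whenever A is inhabited. *)
Definition bellman (R : realType) (S A : finType) (P : S -> A -> S -> R)
    (r : S -> A -> R) (v : S -> R) (s : S) : R :=
  \big[Num.max/0]_(a : A) (r s a + \sum_(s' : S) P s a s' * v s').

(* Stages are numbered from 1: v*_(H+1) = 0 and v*_h = bellman v*_(h+1) for
   1 <= h <= H. *)
Definition opt_value (R : realType) (S A : finType) (P : S -> A -> S -> R)
    (r : S -> A -> R) (H h : nat) : S -> R :=
  iter (H.+1 - h) (bellman P r) (fun=> 0).

Definition sup_norm (R : realType) (S : finType) (f : S -> R) : R :=
  \big[Num.max/0]_(s : S) `|f s|.

(* The oracle calls made so far, oldest first: the entry ((s, a), s') is a call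
   on (s, a) answered by s'. *)
Definition transcript (S A : finType) := seq ((S * A) * S).

(* A randomized adaptive algorithm with access to a sampling oracle. It draws
   its coins once from an arbitrary probability space; given the coins and the
   transcript so far it either calls the oracle on the pair (s, a)
   ([query = Some (s, a)]) or halts ([query = None]) and returns [output].
   Nothing forces it to halt, and the number of calls may be unbounded. *)
Record algorithm (R : realType) (S A : finType) := Algorithm {
  coins_display : measure_display;
  coins : measurableType coins_display;
  coins_law : probability coins R;
  query : transcript S A -> coins -> option (S * A);
  output : transcript S A -> coins -> S -> R;
  measurable_query : forall t q, measurable [set w | query t w = q];
  measurable_output : forall t s, measurable_fun setT (fun w => output t w s)
}.

Definition issues (R : realType) (S A : finType) (K : algorithm R S A) (n : nat)
    (t : n.-tuple ((S * A) * S)) (w : coins K) : Prop :=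
  forall i : 'I_n, query (take i t) w = Some (tnth t i).1.

Definition answers_prob (R : realType) (S A : finType) (P : S -> A -> S -> R)
    (t : transcript S A) : R :=
  \prod_(x <- t) P x.1.1 x.1.2 x.2.

(* Probability that K, run on an oracle for P, makes at least n calls and that,
   writing t for the transcript of the first n calls and w for the coins,
   E t w holds. The coins are independent of the oracle and the oracle's samples
   are independent of each other, whence the product. *)
Definition run_prob (R : realType) (S A : finType) (K : algorithm R S A)
    (P : S -> A -> S -> R) (n : nat) (E : transcript S A -> coins K -> Prop)
    : \bar R :=
  (\sum_(t : n.-tuple ((S * A) * S))
     coins_law K [set w | issues t w /\ E t w] * (answers_prob P t)%:E)%E.

Definition success_prob (R : realType) (S A : finType) (K : algorithm R S A)
    (P : S -> A -> S -> R) (good : (S -> R) -> Prop) : \bar R :=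
  (\sum_(0 <= n <oo)
     run_prob P n (fun t (w : coins K) => query t w = None /\ good (output t w)))%E.

(* E[N] = \sum_(n >= 0) Pr[N >= n + 1], where N is the (possibly infinite)
   number of oracle calls. *)
Definition expected_calls (R : realType) (S A : finType) (K : algorithm R S A)
    (P : S -> A -> S -> R) : \bar R :=
  (\sum_(0 <= n <oo) run_prob P n.+1 (fun _ (_ : coins K) => True))%E.

(* An algorithm for H-MDPs on S and A knows the reward, and accesses the
   transition probabilities only through the oracle. *)
Definition solves_hmdp (R : realType) (S A : finType) (H : nat) (eps delta : R)
    (K : (S -> R) -> algorithm R S A) : Prop :=
  forall (P : S -> A -> S -> R) (r : S -> R),
    is_transition P -> is_reward r ->
    ((1 - delta)%:E <=
       success_prob (K r) P
         (fun v => (sup_norm (fun s => v s - opt_value P (fun s _ => r s) H 1 s)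
                      <= eps)%R))%E.

(* Main.v *)
Require Import Defs.
From HB Require Import structures.
From mathcomp Require Import all_boot all_order all_algebra.
From mathcomp Require Import all_classical all_reals all_analysis.
From mathcomp Require Import ring lra.

Set Implicit Arguments.
Unset Strict Implicit.
Unset Printing Implicit Defensive.

Import Order.TTheory GRing.Theory Num.Theory.

Local Open Scope classical_set_scope.
Local Open Scope ring_scope.

(** In the null instance every state but one absorbing, reward-free state z has
    reward 1 and loops with probability p under every action, falling to z
    otherwise. Its value is the sum of the p ^ k for k < H. With
    p = 1 - 1 / (2 H), raising p to p' at a single pair q moves the value of one
    state by more than 2 eps as soon as p' - p is of order eps / H ^ 2; then
    kap := 1 + (p' - p) ^ 2 / (p' (1 - p')) satisfies
    kap - 1 = O(eps ^ 2 / H ^ 3).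

    A run of the algorithm calling q at most m times has probabilities A0 and A1
    under the null and the perturbed instance with
    A0 ^ 2 <= kap ^ m * A1 * AQ, where AQ is its probability under a third
    transition kernel; so events of probability bounded below under the null
    instance, on which q is called at most m = O(1 / (kap - 1)) times, keep a
    probability bounded below under the perturbed one. Hence every pair (s, a)
    with s <> z must be called of order H ^ 3 / eps ^ 2 times on average under
    the null instance, and these averages add up over the pairs. *)

(** * Looping kernels with one absorbing state, and their optimal values *)

Section Loop.
Context {R : realType} {S A : finType}.
Implicit Types (z s : S) (a : A) (rho : S -> A -> R) (v : S -> R).

Definition loop z rho s a s' : R :=
  rho s a * (s' == s)%:R + (1 - rho s a) * (s' == z)%:R.

Lemma sum_two_points (x y : R) s z v :
  \sum_s' (x * (s' == s)%:R + y * (s' == z)%:R) * v s' = x * v s + y * v z.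
Proof.
have one w u : \sum_s' (w * (s' == u)%:R) * v s' = w * v u :> R.
  rewrite (bigD1 u) //= eqxx mulr1 big1 ?addr0 // => s' /negbTE ->.
  by rewrite mulr0 mul0r.
by rewrite -!one -big_split; apply: eq_bigr => s' _; rewrite mulrDl.
Qed.

Lemma loop_transition z rho :
  (forall s a, 0 <= rho s a <= 1) -> is_transition (loop z rho).
Proof.
move=> rho01 s a; have /andP[rho0 rho1] := rho01 s a; split=> [s'|].
  by rewrite addr_ge0 // mulr_ge0 // subr_ge0.
under eq_bigr do rewrite -[loop _ _ _ _ _]mulr1.
by rewrite (sum_two_points _ _ _ _ (fun=> 1)); ring.
Qed.

(** From [s] only [s] and the worthless state [z] can be reached, so the value obeys v_(n+1) = 1 + p
    v_n whatever [rho] is at the other states; the maximum selects the largest loop probability. *)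
Lemma loop_value z rho s (p : R) n :
  (forall s a, 0 <= rho s a <= 1) -> s != z ->
  (forall a, rho s a <= p) -> (exists a, rho s a = p) ->
  iter n (bellman (loop z rho) (fun s _ => (s != z)%:R)) (fun=> 0) s =
  \sum_(k < n) p ^+ k.
Proof.
move=> rho01 sz rho_le [b rho_b].
pose v n := iter n (bellman (loop z rho) (fun s _ => (s != z)%:R)) (fun=> 0).
have p0 : 0 <= p by rewrite -rho_b; case/andP: (rho01 s b).
have vz k : v k z = 0.
  elim: k => // k IHk; rewrite /v iterS; apply: big1_idem => [|a _]; first exact: maxxx.
  by rewrite sum_two_points -/(v k) IHk eqxx /= !mulr0 !addr0.
rewrite -/(v n s); elim: n => [|n IHn]; first by rewrite big_ord0.
have vn0 : 0 <= v n s by rewrite IHn sumr_ge0 // => k _; exact: exprn_ge0.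
have -> : \sum_(k < n.+1) p ^+ k = 1 + p * v n s.
  rewrite big_ord_recl expr0 IHn mulr_sumr; congr (_ + _).
  by apply: eq_bigr => k _; rewrite -exprS.
have qE a : (s != z)%:R + \sum_s' loop z rho s a s' * v n s' = 1 + rho s a * v n s.
  by rewrite sum_two_points vz sz mulr0 addr0.
rewrite /v iterS -/(v n) /bellman; apply/eqP; rewrite eq_le; apply/andP; split.
  apply: bigmax_le => [|a _]; first by rewrite addr_ge0 // mulr_ge0.
  by rewrite qE lerD2l ler_wpM2r.
by rewrite -rho_b -qE; apply: (le_bigmax_cond _ (fun a => _ + _)).
Qed.

End Loop.

(** * Elementary inequalities and the choice of the two loop probabilities *)

Lemma pow1D_le2 (R : realFieldType) (x : R) m :
  0 <= x -> x * m%:R <= 1 / 2 -> (1 + x) ^+ m <= 2.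
Proof.
move=> x0 xm.
case: m xm => [|m] xm; first by rewrite expr0; lra.
have x1 : x <= 1 / 2.
  apply: le_trans xm; rewrite ler_peMr // ler1n //.
(* Bernoulli bounds the power of 1 - x below by 1 / 2; its product with the power of 1 + x is at
   most 1. *)
have bern k : 1 - x * k%:R <= (1 - x) ^+ k.
  elim: k => [|k IHk]; first by rewrite expr0 mulr0 subr0.
  rewrite exprS; apply: le_trans (ler_wpM2l _ IHk); last by lra.
  rewrite -natr1; have : 0 <= x * (x * k%:R) by rewrite !mulr_ge0.
  by nra.
have h : (1 - x) ^+ m.+1 >= 1 / 2 by apply: le_trans (bern _); lra.
have : ((1 + x) * (1 - x)) ^+ m.+1 <= 1.
  apply: exprn_ile1; nra.
rewrite exprMn.
have : 0 <= (1 + x) ^+ m.+1 by apply: exprn_ge0; lra.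
nra.
Qed.

(** Convexity: each power q ^ k lies above its tangent at p. *)
Lemma geometric_gap (R : realFieldType) (p q : R) n :
  0 <= p -> p <= q ->
  (q - p) * \sum_(k < n) k%:R * p ^+ k.-1 <=
  \sum_(k < n) q ^+ k - \sum_(k < n) p ^+ k.
Proof.
move=> p0 pq; rewrite mulr_sumr -sumrB; apply: ler_sum => k _.
elim: {k}(k : nat) => [|k IHk]; first by rewrite !expr0; lra.
have -> : (q - p) * (k.+1%:R * p ^+ k.+1.-1) =
    p * ((q - p) * (k%:R * p ^+ k.-1)) + (q - p) * p ^+ k.
  case: k {IHk} => [|k]; rewrite /= ?expr0; first by ring.
  by rewrite -natr1 exprS; ring.
have := ler_wpM2l p0 IHk.
have : (q - p) * p ^+ k <= (q - p) * q ^+ k.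
  by apply: ler_wpM2l; [lra | apply: lerXn2r => //; rewrite nnegrE; lra].
rewrite !exprS; nra.
Qed.

Lemma sum_nat_ratio (R : realFieldType) n : 
  \sum_(k < n) k%:R = n%:R * (n%:R - 1) / 2 :> R.
Proof.
elim: n => [|n IHn]; first by rewrite big_ord0 mul0r mul0r.
by rewrite big_ord_recr /= IHn -natr1; field.
Qed.

(* The factor 34 ^ 3 absorbs the horizons below 34, for which p = 1 - 1 / (2 H)
   leaves too little room above p; there p and p' are 1 / 2 -+ eps (3 / 2 - eps). *)
Definition horizon_const {R : realType} : R := (34 ^+ 3 * 144)^-1.

(** The value gap forces different answers, the bound on the power lets [m] calls go nearly
    unnoticed, and the last bound gives [m] the order required of each pair. *)
Lemma hard_parameters (R : realType) (H : nat) (eps : R) :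
  (1 < H)%N -> 0 < eps -> eps < 1 / 2 ->
  exists (p q : R) (m : nat),
    [/\ 0 <= p, p < q & q < 1] /\
    [/\ 2 * eps < \sum_(k < H) q ^+ k - \sum_(k < H) p ^+ k,
        (1 + (q - p) ^+ 2 / (q * (1 - q))) ^+ m <= 2 &
        horizon_const * (H%:R ^+ 3 * eps ^- 2) <= m.+1%:R].
Proof.
move=> H1 e0 e2.
(* With kap - 1 = [x], take for [m] the integer part of 1 / (2 x): then [m.+1] is at least 1 and at
   least 1 / (2 x), hence the maximum. *)
suff [p [q [pq g hc]]] : exists p q : R, [/\ [/\ 0 <= p, p < q & q < 1],
    2 * eps < \sum_(k < H) q ^+ k - \sum_(k < H) p ^+ k &
    horizon_const * (H%:R ^+ 3 * eps ^- 2) <=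
      Num.max 1 (q * (1 - q) / (q - p) ^+ 2 / 2)].
  have [p0 plq q1] := pq.
  set x := (q - p) ^+ 2 / (q * (1 - q)).
  have x0 : 0 < x by rewrite divr_gt0 ?exprn_gt0 ?mulr_gt0 //; lra.
  have xE : q * (1 - q) / (q - p) ^+ 2 / 2 = (2 * x)^-1.
    by rewrite /x; field; rewrite !lt0r_neq0 //; lra.
  have y0 : 0 <= (2 * x)^-1 by rewrite invr_ge0; lra.
  exists p, q, (Num.truncn (2 * x)^-1); split=> //; split=> //.
    apply: pow1D_le2; first exact: ltW.
    have /andP[h _] := truncn_itv y0.
    have := ler_wpM2l (ltW x0) h.
    rewrite (_ : x * (2 * x)^-1 = 1 / 2) //.
    by field; rewrite lt0r_neq0.
  apply: (le_trans hc); rewrite xE ge_max ler1n /=.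
  by have /andP[_ /ltW] := truncn_itv y0.
have H0 : 0 < H%:R :> R by rewrite ltr0n; apply: ltn_trans H1.
have e3 : 0 < eps ^- 2 by rewrite invr_gt0 exprn_gt0.
have [H34|H34] := leqP 34 H.
- set h : R := H%:R in H0 *.
  have h34 : 34 <= h by rewrite /h ler_nat.
  have hV : h * h^-1 = 1 by rewrite divff // lt0r_neq0.
  set i := h^-1 in hV.
  have i0 : 0 < i by rewrite invr_gt0.
  have i34 : 34 * i <= 1 by nra.
  (* Since eps < 1 / 2 and H >= 34, [d] is at most 1 / (4 H), which keeps 1 - (p + d) above 1 / (4
     H). The gap will be at least d H (H - 1) / 4 = (17 / 4) eps (1 - 1 / H). *)
  pose p := 1 - i / 2; pose d := 17 * eps * i ^+ 2.
  have d0 : 0 < d by rewrite /d !mulr_gt0 // exprn_gt0.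
  have d1 : d <= i / 4 by rewrite /d expr2; nra.
  exists p, (p + d); split; [split; rewrite /p; lra| |].
    have p0 : 0 <= p by rewrite /p; lra.
    apply: lt_le_trans (geometric_gap H p0 _); last by lra.
    rewrite addrAC subrr add0r.
    (* The powers of p in the slope are at least 1 / 2, by Bernoulli's inequality. *)
    apply: (@lt_le_trans _ _ (d * (\sum_(k < H) k%:R / 2))); last first.
      rewrite ler_pM2l //; apply: ler_sum => k _; rewrite ler_wpM2l //.
      have bern j : 1 - (i / 2) * j%:R <= p ^+ j.
        elim: j => [|j IHj]; first by rewrite expr0 mulr0 subr0.
        rewrite exprS; apply: le_trans (ler_wpM2l _ IHj) => //.
        rewrite -[j.+1%:R]natr1 /p.
        have : 0 <= i * (i * j%:R) by rewrite !mulr_ge0 // ltW.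
        by nra.
      apply: le_trans (bern _).
      have : k.-1%:R <= h by rewrite ler_nat; apply: leq_trans (leq_pred _) (ltnW (ltn_ord k)).
      nra.
    rewrite -mulr_suml sum_nat_ratio -/h /d.
    have -> : 17 * eps * i ^+ 2 * (h * (h - 1) / 2 / 2) =
        17 / 4 * eps * ((h * i) * (h * i) - (h * i) * i) by field.
    by rewrite hV; nra.
  rewrite le_max; apply/orP; right.
  have -> : p + d - p = d by ring.
  have -> : h ^+ 3 * eps ^- 2 = 17 ^+ 2 * i / d ^+ 2.
    by rewrite /d /i; field; rewrite !lt0r_neq0.
  have dd : 0 < d ^- 2 by rewrite invr_gt0 exprn_gt0.
  rewrite mulrA -[leRHS]mulrA [d ^- 2 / 2]mulrC !mulrA ler_pM2r //.
  have : (1 / 2) * (i / 4) <= (p + d) * (1 - (p + d)).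
    by apply: ler_pM; rewrite /p; lra.
  rewrite /horizon_const; nra.
(* This [e] lies strictly between eps and 1 / 2 for every eps in (0, 1 / 2), and the term k = 1
   alone gives a gap of 2 e. *)
- pose e := eps * (3 / 2 - eps).
  have ee : eps < e by rewrite /e; nra.
  have eh : e < 1 / 2 by rewrite /e; nra.
  have e15 : e <= 3 / 2 * eps by rewrite /e; nra.
  exists (1 / 2 - e), (1 / 2 + e); split; [split; lra| |].
    have p0 : 0 <= 1 / 2 - e by lra.
    apply: lt_le_trans (geometric_gap H p0 _); last by lra.
    have -> : 1 / 2 + e - (1 / 2 - e) = 2 * e by ring.
    have : 1 <= \sum_(k < H) k%:R * (1 / 2 - e) ^+ k.-1.
      case: H H1 {H0 H34} => [|[|H]] // _.
      rewrite big_ord_recl big_ord_recl /= expr0 mul0r add0r mulr1 lerDl.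
      by rewrite sumr_ge0 // => k _; rewrite mulr_ge0 // exprn_ge0.
    nra.
  have -> : 1 / 2 + e - (1 / 2 - e) = 2 * e by ring.
  (* Here 144 = 64 * (3 / 2) ^ 2, from e <= 3 / 2 * eps. *)
  have y : horizon_const * (H%:R ^+ 3 * eps ^- 2) <= (64 * e ^+ 2)^-1.
    apply: (@le_trans _ _ (144^-1 * eps ^- 2)).
      rewrite mulrA ler_pM2r // /horizon_const invfM mulrAC ger_pMl ?invr_gt0 //.
      rewrite mulrC ler_pdivrMr ?exprn_gt0 // mul1r lerXn2r ?nnegrE ?ltW //.
      by rewrite ltr_nat.
    have e_gt0 : 0 < e by lra.
    have ee2 : e * e <= 3 / 2 * eps * (3 / 2 * eps) by apply: ler_pM => //; lra.
    rewrite -invfM lef_pV2 ?posrE; first by rewrite !expr2; lra.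
      by rewrite mulr_gt0 ?exprn_gt0.
    by rewrite mulr_gt0 ?exprn_gt0.
  apply: (le_trans y); rewrite le_max.
  (* If 1 / (64 e ^ 2) exceeds 1, its double absorbs the loss of 1 / 8; otherwise the 1 in the
     maximum suffices. *)
  have E : (1 / 2 + e) * (1 - (1 / 2 + e)) / (2 * e) ^+ 2 / 2 = 2 * (64 * e ^+ 2)^-1 - 1 / 8.
    by field; rewrite lt0r_neq0 //; lra.
  rewrite E; have [?|?] := leP (64 * e ^+ 2)^-1 1; first by [].
  by apply/orP; right; lra.
Qed.

(** * Runs of an algorithm: one-step decomposition, stopping and call counts *)

Lemma sum_tuple_rcons (R : nmodType) (T : finType) n (F : n.+1.-tuple T -> R) :
  \sum_(t : n.+1.-tuple T) F t = \sum_(t : n.-tuple T) \sum_(x : T) F [tuple of rcons t x].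
Proof.
rewrite pair_big /=.
pose h (p : n.-tuple T * T) : n.+1.-tuple T := [tuple of rcons p.1 p.2].
have h_inj : injective h.
  move=> [t x] [u y] /(congr1 val) /= /rcons_inj[tu ->].
  by congr (_, _); apply: val_inj.
rewrite (reindex h) //=; apply: onW_bij; apply: inj_card_bij => //.
by rewrite card_tuple card_prod card_tuple expnSr.
Qed.

Section Runs.
Context {R : realType} {S A : finType} (K : algorithm R S A).
Local Notation trans := (S -> A -> S -> R).
Local Notation event := (transcript S A -> coins K -> Prop).
Implicit Types (P Q : trans) (E F : event) (f g : transcript S A -> R).

Definition measurable_event E := forall t, measurable [set w | E t w].

Definition halts : event := fun t w => query t w = None.
Definition calls (q : S * A) : event := fun t w => query t w = Some q.
Definition always : event := fun _ _ => True.

Lemma measurable_halts : measurable_event halts.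
Proof. by move=> t; apply: measurable_query. Qed.

Lemma measurable_calls q : measurable_event (calls q).
Proof. by move=> t; apply: measurable_query. Qed.

Lemma measurable_always : measurable_event always.
Proof. by move=> t; exact: measurableT. Qed.

Hint Resolve measurable_halts measurable_calls measurable_always : core.

Lemma measurable_eventI E F : measurable_event E -> measurable_event F ->
  measurable_event (fun t w => E t w /\ F t w).
Proof. by move=> mE mF t; exact: measurableI (mE t) (mF t). Qed.

Definition law (X : set (coins K)) : R := fine (coins_law K X).

Lemma EFin_law X : measurable X -> (law X)%:E = coins_law K X.
Proof. by move=> mX; rewrite fineK // fin_num_measure. Qed.

Lemma law_ge0 X : 0 <= law X.
Proof. exact: fine_ge0. Qed.

Lemma le_law X Y : measurable X -> measurable Y -> X `<=` Y -> law X <= law Y.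
Proof.
move=> mX mY XY; rewrite -lee_fin !EFin_law //.
by apply: le_measure => //; rewrite inE.
Qed.

Lemma law_split (I : finType) (X : set (coins K)) (Y : I -> set (coins K)) :
  measurable X -> (forall i, measurable (Y i)) ->
  (forall w, exists i, Y i w) -> (forall i j w, Y i w -> Y j w -> i = j) ->
  law X = \sum_i law (X `&` Y i).
Proof.
move=> mX mY Ycov Ydisj; apply: EFin_inj.
rewrite EFin_law // -sumEFin (eq_bigr (fun i => coins_law K (Y i `&` X))); last first.
  by move=> i _; rewrite EFin_law 1?setIC //; apply: measurableI.
rewrite {1}(_ : X = \bigcup_(i in [set` enum I]) (Y i `&` X)); last first.
  rewrite -setI_bigcupl setIidr // => w _.
  by have [i Yi] := Ycov w; exists i => //=; rewrite mem_enum.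
rewrite measure_fin_bigcup //.
- by rewrite -fsbig_seq ?enum_uniq // big_enum.
- move=> i j _ _ [w [[Yi _] [Yj _]]]; exact: Ydisj Yi Yj.
- by move=> i _; apply: measurableI.
Qed.

(** Real-valued, weighted form of [run_prob]: the expectation of [f] at the transcript of the first
    [n] calls, restricted to the runs that make these calls and satisfy [E]. *)
Definition run_mean P n E f : R :=
  \sum_(t : n.-tuple ((S * A) * S))
     law [set w | issues t w /\ E t w] * answers_prob P t * f t.

Lemma measurable_issues n (t : n.-tuple ((S * A) * S)) :
  measurable [set w | issues (K := K) t w].
Proof.
rewrite (_ : [set w | _] = \bigcap_(i in [set: 'I_n])
    [set w | query (take i t) w = Some (tnth t i).1]); last first.
  by apply/seteqP; split=> w /= h i => [_|]; apply: h.
by apply: fin_bigcap_measurable => // i _; apply: measurable_query.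
Qed.

Lemma measurable_run E n (t : n.-tuple ((S * A) * S)) :
  measurable_event E -> measurable [set w | issues (K := K) t w /\ E t w].
Proof. by move=> mE; exact: measurableI (measurable_issues t) (mE t). Qed.

Lemma issues_rcons n (t : n.-tuple ((S * A) * S)) x w :
  issues (K := K) [tuple of rcons t x] w <->
  issues (K := K) t w /\ query t w = Some x.1.
Proof.
have st := size_tuple t; split=> [h|[h hq] i].
  split=> [i|].
    have /= := h (widen_ord (leqnSn n) i).
    rewrite (tnth_nth x) /= nth_rcons st ltn_ord -(tnth_nth x t i).
    by rewrite -cats1 takel_cat // st ltnW.
  have /= := h ord_max.
  by rewrite (tnth_nth x) /= nth_rcons st ltnn eqxx -cats1 -{1}st take_size_cat.
rewrite (tnth_nth x) /= nth_rcons st -cats1.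
have [lt_in|le_ni] := ltnP i n.
  have := h (Ordinal lt_in); rewrite (tnth_nth x) /= => <-.
  by congr query; apply: takel_cat; rewrite st; exact: ltnW.
have -> : (i : nat) = n by apply/eqP; rewrite eqn_leq le_ni -ltnS ltn_ord.
by rewrite eqxx -{1}st take_size_cat.
Qed.

Lemma answers_prob_rcons P (t : transcript S A) x :
  answers_prob P (rcons t x) = answers_prob P t * P x.1.1 x.1.2 x.2.
Proof. by rewrite /answers_prob -cats1 big_cat big_seq1. Qed.

Lemma answers_prob_ge0 P (t : transcript S A) : is_transition P -> 0 <= answers_prob P t.
Proof. by move=> P_tr; apply: prodr_ge0 => x _; have [] := P_tr x.1.1 x.1.2. Qed.

Lemma run_probE P n E : measurable_event E ->
  run_prob P n E = (run_mean P n E (fun=> 1))%:E.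
Proof.
move=> mE; rewrite -sumEFin; apply: eq_bigr => t _.
by rewrite mulr1 EFinM EFin_law //; apply: measurable_run.
Qed.

Lemma run_mean_ge0 P n E f : is_transition P -> (forall t, 0 <= f t) ->
  0 <= run_mean P n E f.
Proof.
move=> P_tr f0; apply: sumr_ge0 => t _.
by rewrite !mulr_ge0 ?law_ge0 ?answers_prob_ge0.
Qed.

Lemma le_run_mean P n E F f g : is_transition P ->
  measurable_event E -> measurable_event F ->
  (forall t w, E t w -> F t w) -> (forall t, 0 <= f t <= g t) ->
  run_mean P n E f <= run_mean P n F g.
Proof.
move=> P_tr mE mF EF fg; apply: ler_sum => t _; have /andP[f0 le_fg] := fg t.
apply: ler_pM => //; first by rewrite mulr_ge0 ?law_ge0 ?answers_prob_ge0.
rewrite ler_wpM2r ?answers_prob_ge0 //.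
by apply: le_law; [exact: measurable_run..|move=> w [? /EF]].
Qed.

(** The values of [query], [None] included, partition the coins. *)
Lemma run_mean_split P n f : run_mean P n always f =
  run_mean P n halts f + \sum_q run_mean P n (calls q) f.
Proof.
pose E (o : option (S * A)) : event := fun t w => query t w = o.
have -> : run_mean P n always f = \sum_o run_mean P n (E o) f.
  rewrite exchange_big /=; apply: eq_bigr => t _; rewrite -!mulr_suml.
  congr (_ * _ * _).
  rewrite (@law_split _ _ (fun o => [set w | query t w = o])).
  - by apply: eq_bigr => o _; congr law; apply/seteqP; split=> w /= [] // [].
  - exact: measurable_run.
  - by move=> o; apply: measurable_query.
  - by move=> w; exists (query t w).
  - by move=> o o' w /= -> ->.
rewrite (bigD1 None) //=; congr (_ + _).
rewrite (reindex_omap Some id) //=; last by case.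
by apply: eq_bigl => q; rewrite eqxx.
Qed.

(** One-step Markov property: the coins and the past fix the pair, and the answer is a fresh draw
    from [P]. *)
Lemma run_mean_next P n f : run_mean P n.+1 always f =
  \sum_q run_mean P n (calls q)
    (fun t => \sum_s' P q.1 q.2 s' * f (rcons t (q, s'))).
Proof.
rewrite /run_mean sum_tuple_rcons [RHS]exchange_big /=; apply: eq_bigr => t _.
under [RHS]eq_bigr do rewrite mulr_sumr.
rewrite pair_bigA; apply: eq_bigr => -[[s a] s'] _ /=.
rewrite answers_prob_rcons !mulrA; congr (law _ * _ * _ * _).
apply/seteqP; split=> w /=; first by case=> /issues_rcons.
by move=> h; split=> //; apply/issues_rcons.
Qed.

Lemma run_meanB P n E f g :
  run_mean P n E (fun t => f t - g t) = run_mean P n E f - run_mean P n E g.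
Proof. by rewrite -sumrB; apply: eq_bigr => t _; rewrite mulrBr. Qed.

Lemma run_meanZ P n E c f :
  run_mean P n E (fun t => c * f t) = c * run_mean P n E f.
Proof. by rewrite mulr_sumr; apply: eq_bigr => t _; rewrite mulrCA. Qed.

Lemma eq_run_mean P n E f g : f =1 g -> run_mean P n E f = run_mean P n E g.
Proof. by move=> fg; apply: eq_bigr => t _; rewrite fg. Qed.

Lemma run_mean0 P f : run_mean P 0 always f = f [::].
Proof.
have tE (t : 0.-tuple ((S * A) * S)) : t = [tuple] by rewrite tuple0.
rewrite /run_mean (big_pred1 [tuple]) => [|t]; last by rewrite [t]tE; apply/esym/eqxx.
rewrite (_ : [set w | _] = setT); last first.
  by apply/seteqP; split=> // w _; split=> // -[].
by rewrite /law probability_setT /answers_prob big_nil !mul1r.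
Qed.

(* Dynkin's formula for the run stopped after M calls. *)
Lemma run_mean_telescope P f M :
  \sum_(n < M) run_mean P n halts f + run_mean P M always f =
  f [::] + \sum_(n < M) \sum_q run_mean P n (calls q)
    (fun t => \sum_s' P q.1 q.2 s' * f (rcons t (q, s')) - f t).
Proof.
elim: M => [|M IHM]; first by rewrite !big_ord0 run_mean0 addrC.
rewrite !big_ord_recr /= addrA -IHM (run_mean_split P M) run_mean_next.
under [X in _ = _ + X]eq_bigr do rewrite run_meanB.
by rewrite sumrB; ring.
Qed.

(** Dynkin's formula for the constant 1, whose increments vanish; the mass of the runs reaching [M]
    calls is dropped. *)
Lemma sum_halts_le1 P M : is_transition P ->
  \sum_(n < M) run_mean P n halts (fun=> 1) <= 1.
Proof.
move=> P_tr; have := run_mean_telescope P (fun=> 1) M.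
rewrite [X in _ = _ + X]big1 ?addr0 => [h|n _].
  by rewrite -[leRHS]h lerDl run_mean_ge0.
apply: big1 => q _; apply: big1 => t _.
have [_ P1] := P_tr q.1 q.2.
by under eq_bigr do rewrite mulr1; rewrite P1 subrr mulr0.
Qed.

Definition ncalls (q : S * A) (t : transcript S A) : nat := count (fun x => x.1 == q) t.

Lemma ncalls_rcons q t x : ncalls q (rcons t x) = (ncalls q t + (x.1 == q))%N.
Proof. by rewrite /ncalls -cats1 count_cat /= addn0. Qed.

(** Expected number of calls on [q] among the first [M] calls; the summand [n] is the probability
    that call number n + 1 is on [q]. *)
Definition mean_calls P M q : R := \sum_(n < M) run_mean P n (calls q) (fun=> 1).

(** Dynkin's formula for the count of calls on [q], which grows by 1 at each of them and is
    unchanged by the others. *)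
Lemma sum_halts_ncalls_le P M q : is_transition P ->
  \sum_(n < M) run_mean P n halts (fun t => (ncalls q t)%:R) <= mean_calls P M q.
Proof.
move=> P_tr; have := run_mean_telescope P (fun t => (ncalls q t)%:R) M.
rewrite add0r [RHS](_ : _ = mean_calls P M q) => [<-|].
  by rewrite lerDl run_mean_ge0.
apply: eq_bigr => n _; rewrite (bigD1 q) //= [X in _ + X]big1 ?addr0.
  apply: eq_run_mean => t; have [_ P1] := P_tr q.1 q.2.
  under eq_bigr do rewrite ncalls_rcons eqxx addn1 -natr1.
  by rewrite -mulr_suml P1; ring.
move=> q' /negbTE q'q; rewrite /run_mean big1 // => t _.
have [_ P1] := P_tr q'.1 q'.2.
under eq_bigr do rewrite ncalls_rcons q'q addn0.
by rewrite -mulr_suml P1 mul1r subrr mulr0.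
Qed.

Lemma sum_mean_calls P M : is_transition P ->
  \sum_(n < M) run_mean P n.+1 always (fun=> 1) = \sum_q mean_calls P M q.
Proof.
move=> P_tr; rewrite exchange_big /=; apply: eq_bigr => n _.
rewrite run_mean_next; apply: eq_bigr => q _; apply: eq_run_mean => t.
by have [_ P1] := P_tr q.1 q.2; under eq_bigr do rewrite mulr1.
Qed.

(** Markov's inequality for the number of calls on [q] in halted runs. *)
Lemma sum_many_calls_le P M E q m : is_transition P -> measurable_event E ->
  (forall t w, E t w -> halts t w) ->
  m.+1%:R * \sum_(n < M) run_mean P n E (fun t => (m < ncalls q t)%:R) <= mean_calls P M q.
Proof.
move=> P_tr mE E_halts; apply: le_trans (sum_halts_ncalls_le M q P_tr).
rewrite mulr_sumr; apply: ler_sum => n _; rewrite -run_meanZ.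
apply: le_run_mean => // t; rewrite mulr_ge0 //=.
by have [lt_m|_] := ltnP m (ncalls q t); rewrite ?mulr1 ?mulr0 ?ler_nat.
Qed.

(** * Change of measure at one pair; [kap] is 1 plus the chi-square divergence there *)

Section ChangeOfMeasure.
Context (P0 P1 : trans) (q : S * A) (kap : R)
  (P0_tr : is_transition P0) (P1_tr : is_transition P1)
  (P0_eq : forall s a s', (s, a) != q -> P0 s a s' = P1 s a s')
  (P0_ac : forall s', P1 q.1 q.2 s' = 0 -> P0 q.1 q.2 s' = 0)
  (kapE : \sum_s' P0 q.1 q.2 s' ^+ 2 / P1 q.1 q.2 s' = kap)
  (kap1 : 1 <= kap).

(* Chosen so that P0 ^ 2 is proportional to tilt * P1; being a transition kernel,
   it gives the halted runs total mass at most 1. *)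
Definition tilt : trans := fun s a s' =>
  if (s, a) == q then P0 s a s' ^+ 2 / P1 s a s' / kap else P0 s a s'.

Lemma tilt_transition : is_transition tilt.
Proof.
move=> s a; rewrite /tilt; case: eqP => [sa|_]; last exact: P0_tr.
split=> [s'|].
  have [P1_0 _] := P1_tr s a.
  by rewrite !divr_ge0 ?sqr_ge0 //; apply: le_trans kap1.
have := kapE; rewrite -sa /= -mulr_suml => ->.
by rewrite divff // gt_eqF // (lt_le_trans ltr01).
Qed.

(** Both sides factor over the calls, and each call on [q] releases one normalising factor [kap].
    Where P1 vanishes, absolute continuity makes both sides 0. *)
Lemma answers_prob_tilt (t : transcript S A) : answers_prob P0 t ^+ 2 =
  kap ^+ ncalls q t * (answers_prob tilt t * answers_prob P1 t).
Proof.
have kap0 : kap != 0 by rewrite gt_eqF // (lt_le_trans ltr01).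
elim: t => [|[[s a] s'] t IHt]; first by rewrite /answers_prob !big_nil expr0 !mulr1 expr1n.
rewrite /answers_prob !big_cons -!/(answers_prob _ t) exprMn IHt /= -/(ncalls q t).
rewrite [tilt s a s']/tilt; case: eqP => [sa|/eqP sa]; last first.
  by rewrite -(P0_eq _ sa) /= add0n; ring.
rewrite add1n [kap ^+ _.+1]exprS; have [P1_0|P1_0] := eqVneq (P1 s a s') 0.
  have := P0_ac; rewrite -sa /= => /(_ _ P1_0) ->.
  by rewrite P1_0; ring.
by field; rewrite kap0 P1_0.
Qed.

(** On transcripts with at most [m] calls on [q], the identity for [tilt] and the
    arithmetic-geometric inequality with weight [lam] give 2 A0 <= lam kap ^ m AQ + A1 / lam. Summed
    over the halted runs, AQ has mass at most 1. *)
Lemma change_of_measure M E m (lam : R) : 0 < lam -> measurable_event E ->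
  (forall t w, E t w -> halts t w) ->
  2 * (\sum_(n < M) run_mean P0 n E (fun=> 1) - mean_calls P0 M q / m.+1%:R) <=
  lam * kap ^+ m + (\sum_(n < M) run_mean P1 n E (fun=> 1)) / lam.
Proof.
move=> lam0 mE E_halts.
pose few t : R := (ncalls q t <= m)%N%:R.
(* Discarding the runs with more than [m] calls on [q] costs what Markov's inequality allows. *)
have le_few : \sum_(n < M) run_mean P0 n E (fun=> 1) - mean_calls P0 M q / m.+1%:R <=
    \sum_(n < M) run_mean P0 n E few.
  rewrite lerBlDl -lerBlDr -sumrB ler_pdivlMr ?ltr0n // mulrC.
  apply: le_trans (sum_many_calls_le M q m P0_tr mE E_halts).
  rewrite ler_pM2l ?ltr0n // ler_sum // => n _; rewrite -run_meanB le_eqVlt.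
  apply/orP; left; apply/eqP/eq_run_mean => t.
  by rewrite /few leqNgt; case: ltnP => _ /=; rewrite ?subr0 ?subrr.
have kap0 : 0 <= kap by apply: le_trans kap1.
have point t : 2 * (answers_prob P0 t * few t) <=
    lam * kap ^+ m * answers_prob tilt t + answers_prob P1 t / lam.
  have A0 := answers_prob_ge0 t P0_tr; have A1 := answers_prob_ge0 t P1_tr.
  have AQ := answers_prob_ge0 t tilt_transition.
  have x0 : 0 <= lam * kap ^+ m * answers_prob tilt t.
    by rewrite !mulr_ge0 ?exprn_ge0 // ltW.
  have y0 : 0 <= answers_prob P1 t / lam by rewrite divr_ge0 // ltW.
  rewrite /few; case: leqP => [le_m|_]; last by rewrite !mulr0 addr_ge0.
  rewrite mulr1 -ler_sqr ?nnegrE ?mulr_ge0 ?addr_ge0 //.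
  have xy : answers_prob P0 t ^+ 2 <=
      lam * kap ^+ m * answers_prob tilt t * (answers_prob P1 t / lam).
    rewrite answers_prob_tilt [leRHS](_ : _ = kap ^+ m * (answers_prob tilt t * answers_prob P1 t)).
      by rewrite ler_wpM2r ?mulr_ge0 // ler_weXn2l.
    by field; rewrite gt_eqF.
  set x := lam * _ * _ in xy x0 *; set y := _ / lam in xy y0 *.
  by have := sqr_ge0 (x - y); rewrite !expr2 in xy *; lra.
have amgm n : 2 * run_mean P0 n E few <=
    lam * kap ^+ m * run_mean tilt n halts (fun=> 1) + run_mean P1 n E (fun=> 1) / lam.
  apply: (@le_trans _ _ (lam * kap ^+ m * run_mean tilt n E (fun=> 1) +
      run_mean P1 n E (fun=> 1) / lam)).
    rewrite !mulr_sumr mulr_suml -big_split; apply: ler_sum => t _ /=.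
    by have := ler_wpM2l (law_ge0 [set w | issues (K := K) t w /\ E t w]) (point t); lra.
  rewrite lerD2r ler_wpM2l //; first by rewrite mulr_ge0 ?exprn_ge0 // ltW.
  apply: le_run_mean => //; first exact: tilt_transition.
  by move=> t; rewrite ler01 lexx.
apply: (le_trans (ler_wpM2l _ le_few)) => //.
rewrite mulr_sumr; apply: (@le_trans _ _ (\sum_(n < M)
    (lam * kap ^+ m * run_mean tilt n halts (fun=> 1) + run_mean P1 n E (fun=> 1) / lam))).
  by apply: ler_sum => n _; apply: amgm.
rewrite big_split /= -mulr_suml lerD2r -mulr_sumr ler_piMr ?sum_halts_le1 //.
- by rewrite mulr_ge0 ?exprn_ge0 // ltW.
- exact: tilt_transition.
Qed.
End ChangeOfMeasure.
End Runs.

(** * Success events and the comparison of two instances *)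

Lemma partial_sums_ge (R : realType) (u : nat -> R) (x y : R) :
  (forall n, 0 <= u n) -> (x%:E <= \sum_(0 <= n <oo) (u n)%:E)%E -> y < x ->
  exists M, forall N, (M <= N)%N -> y <= \sum_(n < N) u n.
Proof.
move=> u0 xle yx; have [//|no_M] := pselect (exists M, y <= \sum_(n < M) u n).
  move=> [M hM]; exists M => N MN; apply: (le_trans hM).
  rewrite -!(big_mkord xpredT u) [leRHS](big_cat_nat (n := M)) //= lerDl.
  exact: sumr_ge0.
have : (\sum_(0 <= n <oo) (u n)%:E <= y%:E)%E.
  apply: lime_le; first by apply: is_cvg_nneseries => n _ _; rewrite lee_fin.
  near=> M; rewrite sumEFin lee_fin big_mkord leNgt; apply/negP => /ltW yM.
  by apply: no_M; exists M.
move=> /(le_trans xle); rewrite lee_fin; lra.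
Unshelve. all: by end_near.
Qed.

Lemma le_sup_norm (R : realType) (S : finType) (f : S -> R) (e : R) : 0 <= e ->
  (sup_norm f <= e) = [forall s, `|f s| <= e].
Proof.
move=> e0; apply/idP/forallP => [fe s|fe].
  exact: le_trans (le_bigmax _ (fun s => `|f s|) s) fe.
exact: bigmax_le.
Qed.

Section Success.
Context {R : realType} {S A : finType} (K : algorithm R S A).

Definition close (V : S -> R) (e : R) (v : S -> R) : Prop :=
  sup_norm (fun s => v s - V s) <= e.

Definition succeeds (V : S -> R) (e : R) (t : transcript S A) (w : coins K) : Prop :=
  query t w = None /\ close V e (output t w).

Lemma measurable_succeeds V e : 0 <= e -> measurable_event (succeeds V e).
Proof.
move=> e0; suff mG : measurable_event (fun t (w : coins K) => close V e (output t w)).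
  exact: measurable_eventI (@measurable_halts _ _ _ K) mG.
move=> t; rewrite /close (_ : [set w | _] = \bigcap_(s in [set: S])
    ((fun w => output t w s) @^-1` `[V s - e, V s + e])); last first.
  apply/seteqP; split=> w /=.
    rewrite le_sup_norm // => /forallP h s _.
    by have := h s; rewrite ler_distl /= in_itv.
  move=> h; rewrite le_sup_norm //; apply/forallP => s.
  by have := h s I; rewrite ler_distl /= in_itv.
apply: fin_bigcap_measurable => // s _.
rewrite -[X in measurable X]setTI; exact: measurable_output.
Qed.

(** Holding for all large [N], the bound lets two instances share one cutoff. *)
Lemma success_partial_sums P V e (x y : R) : is_transition P -> 0 <= e ->
  (x%:E <= success_prob K P (close V e))%E ->
  y < x ->
  exists M, forall N, (M <= N)%N ->
    y <= \sum_(n < N) run_mean P n (succeeds V e) (fun=> 1).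
Proof.
move=> P_tr e0 xle.
apply: (@partial_sums_ge _ (fun n => run_mean P n (succeeds V e) (fun=> 1)) x) => [n|].
  exact: run_mean_ge0.
have mE := measurable_succeeds V e0.
by under eq_eseriesr do rewrite -run_probE //.
Qed.

(** No output is within [e] of both values at [s], so the two successes are disjoint halting
    events. *)
Lemma disjoint_succeed_le1 P V V' e s M : is_transition P -> 0 <= e ->
  2 * e < V' s - V s ->
  \sum_(n < M) run_mean P n (succeeds V e) (fun=> 1) +
  \sum_(n < M) run_mean P n (succeeds V' e) (fun=> 1) <= 1.
Proof.
move=> P_tr e0 gap; apply: le_trans (sum_halts_le1 K M P_tr).
rewrite -big_split /=; apply: ler_sum => n _; rewrite -big_split /=.
apply: ler_sum => t _; rewrite !mulr1 -mulrDl ler_wpM2r ?answers_prob_ge0 //.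
have mV := measurable_run t (measurable_succeeds V e0).
have mV' := measurable_run t (measurable_succeeds V' e0).
have mH := measurable_run t (@measurable_halts _ _ _ K).
rewrite -lee_fin EFinD !EFin_law // -measureU //.
  apply: le_measure; rewrite ?inE //; first exact: measurableU.
  by move=> w [] [? []].
apply/seteqP; split=> // w /= [[_ [_ hV]] [_ [_ hV']]].
move: hV hV'; rewrite /close !le_sup_norm // => /forallP/(_ s) + /forallP/(_ s).
rewrite !ler_distl => /andP[? ?] /andP[? ?]; lra.
Qed.

(* If calls on q were rare under P0, the value of P0 would still be returned with
   probability over 1 / 10 under P1. The success probability is lowered to 17 / 20
   to be reached by finite partial sums. *)
Lemma distinguishing_calls P0 P1 (q : S * A) kap V0 V1 e s m :
  is_transition P0 -> is_transition P1 ->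
  (forall s a s', (s, a) != q -> P0 s a s' = P1 s a s') ->
  (forall s', P1 q.1 q.2 s' = 0 -> P0 q.1 q.2 s' = 0) ->
  \sum_s' P0 q.1 q.2 s' ^+ 2 / P1 q.1 q.2 s' = kap -> 1 <= kap ->
  kap ^+ m <= 2 -> 0 <= e -> 2 * e < V1 s - V0 s ->
  ((1 - 1 / 10)%:E <= success_prob K P0 (close V0 e))%E ->
  ((1 - 1 / 10)%:E <= success_prob K P1 (close V1 e))%E ->
  exists M, forall N, (M <= N)%N -> m.+1%:R / 5 <= mean_calls K P0 N q.
Proof.
move=> P0_tr P1_tr P01 ac kapE kap1 kapm e0 gap ok0 ok1.
have lt9 : 17 / 20 < 1 - 1 / 10 :> R by lra.
have [M0 hM0] := success_partial_sums P0_tr e0 ok0 lt9.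
have [M1 hM1] := success_partial_sums P1_tr e0 ok1 lt9.
exists (maxn M0 M1) => N; rewrite geq_max => /andP[/hM0 h0 /hM1 h1].
have := disjoint_succeed_le1 N P1_tr e0 gap.
(* Under P1 the value of P0 is returned with mass at most 3 / 20. With lam = 3 / 10 the right-hand
   side is at most 6 / 10 + 1 / 2, so Markov's term is at least 17 / 20 - 11 / 20 = 3 / 10, above
   the required 1 / 5. *)
have lam0 : 0 < 3 / 10 :> R by lra.
have := change_of_measure P0_tr P1_tr P01 ac kapE kap1 N m lam0 (measurable_succeeds V0 e0)
  (fun t w h => h.1).
rewrite invf_div => com disj; rewrite mulrC -ler_pdivlMr ?ltr0n //.
move: com; set y := mean_calls K P0 N q / _; lra.
Qed.

End Success.

Lemma mean_calls_le (R : realType) (S A : finType) (K : algorithm R S A) P M :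
  is_transition P -> ((\sum_q mean_calls K P M q)%:E <= expected_calls K P)%E.
Proof.
move=> P_tr; rewrite -sum_mean_calls // -sumEFin.
apply: le_trans (nneseries_lim_ge M _); last first.
  by move=> n _ _; rewrite run_probE ?lee_fin; [apply: run_mean_ge0|exact: measurable_always].
rewrite big_mkord; apply: lee_sum => n _.
by rewrite -run_probE //; exact: measurable_always.
Qed.

(** * Lower bound on the calls at each pair of the null instance *)

Section HardInstance.
Context {R : realType} {S A : finType} (z : S) (H : nat).
Implicit Types (p : R) (q : S * A).

Definition perturbed p p' q : S -> A -> R := fun s a => if (s, a) == q then p' else p.

Lemma loop_opt_value rho s p :
  (forall s a, 0 <= rho s a <= 1) -> s != z ->
  (forall a, rho s a <= p) -> (exists a, rho s a = p) ->
  opt_value (loop z rho) (fun s (_ : A) => (s != z)%:R) H 1 s = \sum_(k < H) p ^+ k :> R.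
Proof. by move=> *; rewrite /opt_value subSS subn0; apply: loop_value. Qed.

(** The probability at the pair is raised rather than lowered: the value is a maximum over actions,
    so one better action suffices to move it. *)
Lemma hard_pair_calls (K : algorithm R S A) p p' (e : R) m (s : S) (a : A) :
  s != z -> 0 <= p -> p < p' -> p' < 1 -> 0 <= e ->
  2 * e < \sum_(k < H) p' ^+ k - \sum_(k < H) p ^+ k ->
  (1 + (p' - p) ^+ 2 / (p' * (1 - p'))) ^+ m <= 2 ->
  (forall P, is_transition P -> ((1 - 1 / 10)%:E <= success_prob K P
     (close (opt_value P (fun s _ => (s != z)%:R) H 1) e))%E) ->
  exists M, forall N, (M <= N)%N ->
    m.+1%:R / 5 <= mean_calls K (loop z (fun _ _ => p)) N (s, a).
Proof.
move=> sz p0 pp' p'1 e0 gap kapm ok.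
have p01 : 0 <= p <= 1 by rewrite p0 (ltW (lt_trans pp' p'1)).
have p'01 : 0 <= p' <= 1 by rewrite (le_trans p0 (ltW pp')) ltW.
have rho01 s' a' : 0 <= perturbed p p' (s, a) s' a' <= 1.
  by rewrite /perturbed; case: ifP.
have P0_tr := @loop_transition _ _ A z (fun _ _ => p) (fun _ _ => p01).
have P1_tr := loop_transition z rho01.
have zs : (z == s) = false by rewrite eq_sym (negbTE sz).
apply: (distinguishing_calls (s := s) P0_tr P1_tr _ _ _ _ kapm e0 _ (ok _ P0_tr) (ok _ P1_tr)).
- by move=> s1 a1 s' /negbTE ne; rewrite /loop /perturbed ne.
- move=> s' /=; rewrite /loop /perturbed eqxx.
  have [->|_] := eqVneq s' s; first by rewrite (negbTE sz) /=; lra.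
  by case: (s' == z) => /=; lra.
(* Both rows live on [s] and [z]; elsewhere the term is 0 / 0, which is 0. What remains is the
   chi-square sum of two Bernoulli laws. *)
- rewrite /= (eq_bigr (fun s' => (p ^+ 2 / p' * (s' == s)%:R +
      (1 - p) ^+ 2 / (1 - p') * (s' == z)%:R) * 1)); last first.
    move=> s' _; rewrite /loop /perturbed eqxx mulr1.
    have [->|_] := eqVneq s' s; first by rewrite (negbTE sz) !mulr1 !mulr0 !addr0.
    case: (s' == z); first by rewrite !mulr1 !mulr0 !add0r.
    by rewrite !mulr0 !addr0 expr0n mul0r.
  rewrite (sum_two_points _ _ s z (fun=> 1)); field.
  by apply/andP; split; apply/eqP; lra.
- by rewrite lerDl divr_ge0 ?sqr_ge0 // mulr_ge0; lra.
- rewrite (loop_opt_value (p := p') rho01 sz); first last.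
  + by exists a; rewrite /perturbed eqxx.
  + by move=> a'; rewrite /perturbed; case: ifP => _ //; exact: ltW.
  by rewrite (loop_opt_value (fun _ _ => p01) sz (fun _ => lexx p) (ex_intro _ a erefl)).
Qed.

End HardInstance.

(** * Summation over the pairs *)

Theorem theoremF6 (R : realType) :
  exists2 c : R, 0 < c &
    forall (S A : finType) (H : nat) (eps : R)
           (K : (S -> R) -> algorithm R S A),
      (1 < #|S|)%N -> (1 < H)%N -> 0 < eps -> eps < 1 / 2 ->
      solves_hmdp H eps (1 / 10) K ->
      exists (P : S -> A -> S -> R) (r : S -> R),
        [/\ is_transition P, is_reward r &
          ((c * (H%:R ^+ 3 * eps ^- 2 * #|S|%:R * #|A|%:R / ln eps^-1))%:E
             <= expected_calls (K r) P)%E].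
Proof.
have ln2 : 0 < ln 2 :> R by rewrite ln_gt0 // ltr1n.
have hc0 : 0 < horizon_const :> R by rewrite invr_gt0 mulr_gt0 ?exprn_gt0.
(* The 10 is 5 from the bound per pair times 2 from #|S| - 1 >= #|S| / 2; [ln 2] compensates the
   division by ln (1 / eps) >= ln 2. *)
exists (horizon_const / 10 * ln 2); first by rewrite !mulr_gt0 ?invr_gt0.
move=> S A H eps K S1 H1 e0 e2 Kok.
have [z _] : exists z : S, z \in S by apply/card_gt0P; apply: ltnW.
have [p [p' [m [[p0 pp' p'1] [gap kapm hm]]]]] := hard_parameters H1 e0 e2.
(* All instances share this reward, so a single algorithm [K r] faces them and only the oracle
   distinguishes them. *)
pose r (s : S) : R := (s != z)%:R.
have r_ok : is_reward r by move=> s; rewrite /r; case: (s != z); rewrite ?ler01 ?lexx.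
have P_tr : is_transition (loop z (fun (_ : S) (_ : A) => p)).
  by apply: loop_transition => s a; apply/andP; split; lra.
exists (loop z (fun _ _ => p)), r; split=> //.
have calls_ge q : exists M, forall N, (M <= N)%N -> q.1 != z ->
    m.+1%:R / 5 <= mean_calls (K r) (loop z (fun _ _ => p)) N q.
  have [qz|qz] := eqVneq q.1 z; first by exists 0%N => N _ /eqP.
  case: q qz => s a sz.
  have [M hM] := hard_pair_calls a sz p0 pp' p'1 (ltW e0) gap kapm
    (fun P P_tr => Kok P r P_tr r_ok).
  by exists M => N /hM ? _.
have [f hf] := choice calls_ge.
(* The largest of the finitely many thresholds is a cutoff valid for all pairs at once. *)
apply: le_trans (mean_calls_le (K r) (\max_q f q) P_tr); rewrite lee_fin.
have leS : #|S|%:R / 2 <= #|[pred s | s != z]|%:R :> R.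
  have := cardC1 z; rewrite /= => ->.
  rewrite ler_pdivrMr // -natrM ler_nat muln2 -addnn.
  by case: #|S| S1 => // -[|n] // _; rewrite /= addSn ltnS leq_addl.
have sum_ge : #|[pred s | s != z]|%:R * #|A|%:R * (m.+1%:R / 5) <=
    \sum_q mean_calls (K r) (loop z (fun _ _ => p)) (\max_q f q) q.
  rewrite [leRHS](bigID (fun q : S * A => q.1 != z)) /=.
  apply: ler_wpDr; first by apply: sumr_ge0 => q _; apply: sumr_ge0 => n _; apply: run_mean_ge0.
  apply: le_trans (ler_sum _ (fun q qz => hf q _ (leq_bigmax q) qz)).
  have cardE : #|[pred q : S * A | q.1 != z]| = (#|[pred s | s != z]| * #|A|)%N.
    by rewrite -cardX; apply: eq_card => -[s a]; rewrite !inE andbT.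
  by rewrite (sumr_const [pred q : S * A | q.1 != z]) cardE -natrM mulr_natl.
apply: le_trans sum_ge.
have lnE : ln 2 <= ln eps^-1.
  rewrite ler_ln ?posrE ?invr_gt0 // -[2]invrK lef_pV2 ?posrE ?invr_gt0 //.
  lra.
have -> : horizon_const / 10 * ln 2 * (H%:R ^+ 3 * eps ^- 2 * #|S|%:R * #|A|%:R / ln eps^-1) =
   (#|S|%:R / 2) * #|A|%:R * (horizon_const * (H%:R ^+ 3 * eps ^- 2) / 5) * (ln 2 / ln eps^-1).
  by field; rewrite !gt_eqF // (lt_le_trans ln2).
have W0 : 0 <= horizon_const * (H%:R ^+ 3 * eps ^- 2) :> R.
  by rewrite !mulr_ge0 ?invr_ge0 ?exprn_ge0 // ltW.
apply: le_trans (ler_piMr _ _) _.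
- by apply: mulr_ge0; [apply: mulr_ge0; rewrite ?divr_ge0 | exact: divr_ge0].
- by rewrite ler_pdivrMr ?mul1r // (lt_le_trans ln2).
- apply: ler_pM; first (by rewrite mulr_ge0 ?divr_ge0); first exact: divr_ge0.
    by rewrite ler_wpM2r.
  by rewrite ler_pM2r // invr_gt0.
Qed.
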